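(* Let $\rho$ be the norm on $\mathbb{R}^2$ defined by $\rho(x,y)=|x|+\max(|x|,|y|)$. There exists some $f_0\in\mathbb{R}^2$ such that the problem $$\inf\{\rho(f_0-x)+\rho^*(x):\ x\in\mathbb{R}^2\}$$ admits infinitely many solutions. In particular, the closed dual unit ball $\{y\in\mathbb{R}^2:\rho^\circ(y)\le 1\}$ associated to $\rho$ is not a Chebyshev set with respect to $\rho$.
   Context: $\mathbb{R}^2$ carries its standard scalar product $x\cdot y$. The Legendre transform of $\rho$ is $\rho^*(y)=\sup\{x\cdot y-\rho(x):x\in\mathbb{R}^2\}\in[0,\infty]$, and the dual norm is $\rho^\circ(y)=\max\{x\cdot y:x\in\mathbb{R}^2,\ \rho(x)\le1\}$. A solution is a point attaining the infimum. A subset $D$ of a normed vector space $\mathcal{X}$ is a Chebyshev set with respect to the norm $\rho$ if for every $x_0\in\mathcal{X}$ the problem $\inf\{\rho(x-x_0):x\in D\}$ admits a unique solution. *)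

(* Defs.v *)
From HB Require Import structures.
From mathcomp Require Import all_boot all_order all_algebra.
From mathcomp Require Import all_classical all_reals all_analysis.
From mathcomp Require Import lra.

Set Implicit Arguments.
Unset Strict Implicit.
Unset Printing Implicit Defensive.

Import Order.TTheory GRing.Theory Num.Theory.

Local Open Scope classical_set_scope.
Local Open Scope ring_scope.

(* A norm is a bundled function rather than a [normedModType] instance, because
   ['rV[R]_2] already carries the sup norm as its canonical norm. *)
Record norm (R : realType) (E : lmodType R) := Norm {
  norm_fun :> E -> R;
  norm_triangle : forall x y, norm_fun (x + y) <= norm_fun x + norm_fun y;
  norm_homogeneous : forall (a : R) x, norm_fun (a *: x) = `|a| * norm_fun x;
  norm_definite : forall x, norm_fun x = 0 -> x = 0
}.

Definition dotp (R : realType) (n : nat) (x y : 'rV[R]_n) : R :=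
  \sum_(i < n) x 0 i * y 0 i.

Definition legendre (R : realType) (n : nat) (f : 'rV[R]_n -> R)
    (y : 'rV[R]_n) : \bar R :=
  ereal_sup [set (dotp x y - f x)%:E | x in setT].

(* [sup] is the maximum here: the unit ball of a norm on a finite-dimensional
   space is compact and contains 0. *)
Definition dual_norm (R : realType) (n : nat) (N : norm 'rV[R]_n)
    (y : 'rV[R]_n) : R :=
  sup [set dotp x y | x in [set x | N x <= 1]].

Definition solutions (R : realType) (T : Type) (D : set T) (F : T -> \bar R) :
    set T :=
  [set x | D x /\ F x = ereal_inf (F @` D)].

Definition chebyshev_set (R : realType) (E : lmodType R) (N : norm E)
    (D : set E) : Prop :=
  forall x0 : E, exists! x, solutions D (fun x => (N (x - x0))%:E) x.

Section Rho.
Variable R : realType.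

Definition rho_fun (v : 'rV[R]_2) : R :=
  `|v 0 0| + Num.max `|v 0 0| `|v 0 1|.

Lemma rho_triangle (v w : 'rV[R]_2) : rho_fun (v + w) <= rho_fun v + rho_fun w.
Proof.
rewrite /rho_fun !mxE addrACA lerD ?ler_normD// ge_max.
by rewrite !(le_trans (ler_normD _ _))// lerD// le_max lexx ?orbT.
Qed.

Lemma rho_homogeneous (a : R) (v : 'rV[R]_2) :
  rho_fun (a *: v) = `|a| * rho_fun v.
Proof. by rewrite /rho_fun !mxE !normrM mulrDr maxr_pMr. Qed.

Lemma rho_definite (v : 'rV[R]_2) : rho_fun v = 0 -> v = 0.
Proof.
rewrite /rho_fun => v0.
have h0 : `|v 0 0| <= Num.max `|v 0 0| `|v 0 1| by rewrite le_max lexx.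
have h1 : `|v 0 1| <= Num.max `|v 0 0| `|v 0 1| by rewrite le_max lexx orbT.
have p0 := normr_ge0 (v 0 0); have p1 := normr_ge0 (v 0 1).
have e0 : v 0 0 = 0 by apply/eqP; rewrite -normr_eq0; apply/eqP; lra.
have e1 : v 0 1 = 0 by apply/eqP; rewrite -normr_eq0; apply/eqP; lra.
apply/rowP => i; rewrite mxE.
case: (unliftP 0 i) => [j ->|->] //; rewrite (ord1 j).
by rewrite -[RHS]e1; congr (v 0 _); apply/val_inj.
Qed.

Definition rho : norm 'rV[R]_2 :=
  Norm rho_triangle rho_homogeneous rho_definite.

End Rho.

(* Main.v *)
Require Import Defs.
From mathcomp Require Import all_boot all_order all_algebra.
From mathcomp Require Import all_classical all_reals all_analysis.
From mathcomp Require Import lra.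

Set Implicit Arguments.
Unset Strict Implicit.
Unset Printing Implicit Defensive.

Import Order.TTheory GRing.Theory Num.Theory.

Local Open Scope classical_set_scope.
Local Open Scope ring_scope.

(** The unit ball of [rho] is the hexagon with vertices [(0, +-1)] and
    [(+-1/2, +-1/2)]; its polar, the dual ball, is the hexagon with vertices
    [(+-2, 0)] and [(+-1, +-1)].  Non-uniqueness comes from a pair of parallel
    edges: the edge of the dual ball joining [(2, 0)] to [(1, 1)] and the edge
    of the unit ball joining [(0, 1)] to [(1/2, 1/2)] are both orthogonal to
    [(1, 1)].  Seen from [f0 = (2, 2)], the whole edge
    [{(2 - t, t) : 0 <= t <= 1}] of the dual ball is therefore at the same
    [rho]-distance 2, and nothing in the dual ball is closer.

    The bound from below comes from one linear form.  As [(1, 1)] lies in the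
    dual ball, [rho (f0 - x) >= 4 - (x0 + x1)]; and evaluating the Legendre
    transform at [(1, 1)], where [rho] is 2, gives
    [legendre rho x >= (x0 + x1) - 2].  The sum is at least 2 for every [x]
    ([penalized_ge2]).  The bound from above is [polar_edge], which says that
    the edge lies in the dual ball, so that the Legendre transform is at most 0
    there, together with [rho_edge].  On the dual ball itself the form
    [x0 + x1] is at most 2, so the same edge consists of nearest points of
    [f0], and [(2, 0)] and [(1, 1)] contradict uniqueness. *)

(** * Minimizers and the polar condition *)

Lemma solutions_of_bound (R : realType) (T : Type) (D : set T)
    (F : T -> \bar R) (m : \bar R) (x : T) :
  (forall y, D y -> (m <= F y)%E) -> D x -> (F x <= m)%E -> solutions D F x.
Proof.
move=> mF Dx Fxm; split => //; apply/eqP; rewrite eq_le; apply/andP; split.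
  by apply/ereal_infP => _ [y Dy <-]; exact: le_trans Fxm (mF y Dy).
by apply: ereal_inf_lbound; exists x.
Qed.

Lemma legendre_ge (R : realType) (n : nat) (f : 'rV[R]_n -> R)
    (u y : 'rV[R]_n) : ((dotp u y - f u)%:E <= legendre f y)%E.
Proof. by apply: ereal_sup_ubound; exists u. Qed.

Lemma legendre_le0 (R : realType) (n : nat) (f : 'rV[R]_n -> R)
    (y : 'rV[R]_n) :
  (forall u, dotp u y <= f u) -> (legendre f y <= 0)%E.
Proof.
by move=> yf; apply/ereal_supP => _ [u _ <-]; rewrite lee_fin subr_le0.
Qed.

Lemma norm0 (R : realType) (E : lmodType R) (N : norm E) : N 0 = 0.
Proof. by rewrite -(scale0r 0) norm_homogeneous normr0 mul0r. Qed.

Lemma norm_opp (R : realType) (E : lmodType R) (N : norm E) (x : E) :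
  N (- x) = N x.
Proof. by rewrite -scaleN1r norm_homogeneous normrN normr1 mul1r. Qed.

Lemma dual_norm_le1 (R : realType) (n : nat) (N : norm 'rV[R]_n)
    (y : 'rV[R]_n) : (forall u, dotp u y <= N u) -> dual_norm N y <= 1.
Proof.
move=> yN; apply: ge_sup; last first.
  by move=> _ [x /= Nx <-]; exact: le_trans (yN x) Nx.
by exists (dotp 0 y); exists 0 => //=; rewrite norm0.
Qed.

(** * The hexagonal norm *)

Section Plane.
Variable R : realType.

Definition vec2 (a b : R) : 'rV[R]_2 := \row_i (if i == 0 then a else b).

Lemma vec2_0 a b : vec2 a b 0 0 = a.
Proof. by rewrite mxE. Qed.

Lemma vec2_1 a b : vec2 a b 0 1 = b.
Proof. by rewrite mxE. Qed.

Lemma dotp2 (x y : 'rV[R]_2) : dotp x y = x 0 0 * y 0 0 + x 0 1 * y 0 1.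
Proof.
rewrite /dotp !big_ord_recl big_ord0 addr0.
by congr (_ + x 0 _ * y 0 _); apply/val_inj.
Qed.

Lemma rhoE (v : 'rV[R]_2) :
  rho R v = `|v 0 0| + Num.max `|v 0 0| `|v 0 1|.
Proof. by []. Qed.

Lemma rho_ge_abs (v : 'rV[R]_2) :
  `|v 0 0| + `|v 0 0| <= rho R v /\ `|v 0 0| + `|v 0 1| <= rho R v.
Proof. by rewrite rhoE !lerD2l !le_max !lexx orbT. Qed.

Lemma rho_ge_sum (v : 'rV[R]_2) : v 0 0 + v 0 1 <= rho R v.
Proof.
by apply: le_trans (rho_ge_abs v).2; rewrite lerD ?ler_norm.
Qed.

(** Over a general norm, the boundedness that makes the supremum in
    [dual_norm] meaningful rests on the equivalence of norms in finite
    dimension; for [rho] it follows from [rho] dominating both coordinates. *)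
Lemma dotp_le_dual_norm (u y : 'rV[R]_2) :
  rho R u <= 1 -> dotp u y <= dual_norm (rho R) y.
Proof.
move=> u1; apply: ub_le_sup; last by exists u.
exists (`|y 0 0| + `|y 0 1|) => _ [x x1 <-]; rewrite dotp2.
have xr := le_trans (rho_ge_abs x).2 x1.
have [x0p x1p] := (normr_ge0 (x 0 0), normr_ge0 (x 0 1)).
rewrite (le_trans (ler_norm _))// (le_trans (ler_normD _ _))// !normrM.
by rewrite lerD// ler_piMl//; lra.
Qed.

(** Half of the form [y0 + y1] is the pairing of [y] with [(1/2, 1/2)], a
    vertex of the unit ball. *)
Lemma dual_ball_sum_le2 (y : 'rV[R]_2) :
  dual_norm (rho R) y <= 1 -> y 0 0 + y 0 1 <= 2.
Proof.
move=> y1; have : dotp (vec2 2^-1 2^-1) y <= 1.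
  apply: le_trans y1; apply: dotp_le_dual_norm.
  rewrite rhoE vec2_0 vec2_1 maxxx ger0_norm ?invr_ge0//.
  by lra.
by rewrite dotp2 vec2_0 vec2_1; lra.
Qed.

(** * The edge of nearest points *)

Definition edge (t : R) : 'rV[R]_2 := vec2 (2 - t) t.

(** [(2 - t) a + t b] is the convex combination of [2 a] and [a + b], and [rho]
    dominates both. *)
Lemma polar_edge (t : R) (u : 'rV[R]_2) :
  0 <= t <= 1 -> dotp u (edge t) <= rho R u.
Proof.
move=> /andP[t0 t1]; rewrite dotp2 vec2_0 vec2_1.
have [r0 _] := rho_ge_abs u; have r1 := rho_ge_sum u.
have u0 := ler_norm (u 0 0).
have h0 : (1 - t) * (u 0 0 + u 0 0) <= (1 - t) * rho R u.
  by apply: ler_wpM2l; lra.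
have h1 : t * (u 0 0 + u 0 1) <= t * rho R u by apply: ler_wpM2l.
by lra.
Qed.

(** The difference is [(t, 2 - t)], twice a point of the edge of the unit ball
    from [(0, 1)] to [(1/2, 1/2)]: this is where [t <= 1] matters. *)
Lemma rho_edge (t : R) : 0 <= t <= 1 -> rho R (vec2 2 2 - edge t) = 2.
Proof.
move=> /andP[t0 t1]; rewrite rhoE !mxE /=.
rewrite (_ : 2 - (2 - t) = t); last by lra.
rewrite !ger0_norm ?subr_ge0; [|lra..].
by rewrite max_r; lra.
Qed.

Lemma rho_to_corner_ge (x : 'rV[R]_2) :
  4 - (x 0 0 + x 0 1) <= rho R (vec2 2 2 - x).
Proof. by have := rho_ge_sum (vec2 2 2 - x); rewrite !mxE /=; lra. Qed.

(** Beyond the line [x0 + x1 = 2] that carries the edge, the distance to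
    [(2, 2)] may drop below 2, but the Legendre transform, tested against the
    normal direction [(1, 1)], rises by at least as much. *)
Lemma penalized_ge2 (x : 'rV[R]_2) :
  (2%:E <= (rho R (vec2 2 2 - x))%:E + legendre (rho R) x)%E.
Proof.
have r11 : rho R (vec2 1 1) = 2.
  by rewrite rhoE vec2_0 vec2_1 maxxx normr1.
have := legendre_ge (rho R) (vec2 1 1) x.
rewrite r11 dotp2 vec2_0 vec2_1 => lx.
apply: le_trans (leeD2l _ lx).
by rewrite -EFinD lee_fin; have := rho_to_corner_ge x; lra.
Qed.

Lemma edge_penalized_solution (t : R) : 0 <= t <= 1 ->
  solutions [set: 'rV[R]_2]
    (fun x => ((rho R (vec2 2 2 - x))%:E + legendre (rho R) x)%E) (edge t).
Proof.
move=> t01; apply: (@solutions_of_bound _ _ _ _ 2%:E) => //.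
  by move=> y _; exact: penalized_ge2.
rewrite rho_edge// -[leRHS]adde0 leeD2l//.
by apply: legendre_le0 => u; exact: polar_edge.
Qed.

Lemma edge_nearest (t : R) : 0 <= t <= 1 ->
  solutions [set y : 'rV[R]_2 | dual_norm (rho R) y <= 1]
    (fun x => (rho R (x - vec2 2 2))%:E) (edge t).
Proof.
move=> t01; apply: (@solutions_of_bound _ _ _ _ 2%:E).
- move=> y /dual_ball_sum_le2 y2; rewrite lee_fin -norm_opp opprB.
  by have := rho_to_corner_ge y; lra.
- by apply: dual_norm_le1 => u; exact: polar_edge.
- by rewrite lee_fin -norm_opp opprB rho_edge.
Qed.

Lemma edge_inj : injective edge.
Proof. by move=> s t /(congr1 (fun v : 'rV[R]_2 => v 0 1)); rewrite !vec2_1. Qed.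

End Plane.

Theorem proposition4p4 (R : realType) :
  (exists f0 : 'rV[R]_2,
     infinite_set
       (solutions [set: 'rV[R]_2]
          (fun x => ((rho R (f0 - x))%:E + legendre (rho R) x)%E)))
  /\ ~ chebyshev_set (rho R) [set y : 'rV[R]_2 | dual_norm (rho R) y <= 1].
Proof.
split.
  exists (vec2 (2 : R) 2) => finS.
  pose p (n : nat) := edge (n.+1%:R^-1 : R).
  have p_inj : injective p.
    by move=> m n /edge_inj/invr_inj/eqP; rewrite eqr_nat eqSS => /eqP.
  apply: infinite_nat; apply: sub_finite_set (finite_preimage (in2W p_inj) finS).
  move=> n _; apply: edge_penalized_solution.
  by rewrite invr_ge0 ler0n invf_le1 ?ltr0n// ler1n.
move=> /(_ (vec2 (2 : R) 2)) [x [_ x_unique]].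
have e0 : edge (0 : R) = x by apply/esym/x_unique/edge_nearest; lra.
have e1 : edge (1 : R) = x by apply/esym/x_unique/edge_nearest; lra.
have /eqP := @edge_inj R 0 1 (etrans e0 (esym e1)).
by rewrite eq_sym oner_eq0.
Qed.
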